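(* Let $\Phi$ be a finite crystallographic root system with Weyl group $W$, and let $C\subseteq W$ be a generalized semiorder with $|C|>1$. Then $b(C)\geq\frac{1}{3}$.
   Context: Let $\Phi$ be a finite (reduced) crystallographic root system spanning a Euclidean space $E$ with positive definite form $\langle\cdot,\cdot\rangle$, with chosen positive roots $\Phi^+$, negative roots $\Phi^-=-\Phi^+$, and simple roots $\Delta=\{\alpha_1,\ldots,\alpha_r\}$. For $\alpha\in\Phi$ let $s_\alpha(x)=x-\frac{2\langle\alpha,x\rangle}{\langle\alpha,\alpha\rangle}\alpha$; the Weyl group $W=W(\Phi)$ is the group generated by all $s_\alpha$. The root poset is the partial order on $\Phi^+$ with $\alpha\le\beta$ iff $\beta-\alpha$ is a non-negative linear combination of simple roots. An order ideal is a down-closed subset. The inversion set of $w\in W$ is $I_\Phi(w)=\{\alpha\in\Phi^+ : w\alpha\in\Phi^-\}$. For $A\subseteq\Phi^+$, let $W^A=\{w\in W : I_\Phi(w)\subseteq A\}$ (these are convex subsets of $W$). A set $C\subseteq W$ is a generalized semiorder if $C=W^A$ for some order ideal $A\subseteq\Phi^+$ of the root poset. For nonempty $C\subseteq W$ and $\alpha\in\Phi^+$ let $C_\alpha=\{w\in C : \alpha\in I_\Phi(w)\}$ and $\delta_C(\alpha)=|C_\alpha|/|C|$. The balance constant is $b(C)=\max_{\alpha\in\Phi^+}\min(\delta_C(\alpha),1-\delta_C(\alpha))$. *)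

(* Defs.v *)
From HB Require Import structures.
From mathcomp Require Import all_boot all_order all_algebra finmap.
From mathcomp Require Import boolp classical_sets functions cardinality reals.
From mathcomp Require Import ring.

Set Implicit Arguments.
Unset Strict Implicit.
Unset Printing Implicit Defensive.

Import Order.TTheory GRing.Theory Num.Theory.

Local Open Scope classical_set_scope.
Local Open Scope ring_scope.

Section RootSystem.
Context {R : realType} {E : vectType R}.
Variable form : {dot E for idfun}.

Definition cartan (a x : E) : R := 2 * form a x / form a a.

Definition reflect_fun (a x : E) : E := x - cartan a x *: a.

Fact reflect_fun_is_linear a : linear (reflect_fun a).
Proof.
move=> k x y; rewrite /reflect_fun /cartan linearPr mulrDr mulrDl scalerDl.
rewrite opprD addrACA scalerBr scalerA; congr (_ - _ + _).
by rewrite /= mulrCA -!mulrA.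
Qed.

HB.instance Definition _ a :=
  GRing.isLinear.Build R E E *:%R (reflect_fun a) (reflect_fun_is_linear a).

Definition reflection (a : E) : 'End(E) := linfun (reflect_fun a).

Lemma reflectionE a x :
  reflection a x = x - (2 * form a x / form a a) *: a.
Proof. by rewrite lfunE. Qed.

Record root_system (Phi : {fset E}) : Prop := RootSystem {
  root_span : <<Phi>>%VS = fullv;
  root_neq0 : 0 \notin Phi;
  root_reduced : forall (a : E) (c : R),
    a \in Phi -> c *: a \in Phi -> c = 1 \/ c = -1;
  root_stable : forall a b : E,
    a \in Phi -> b \in Phi -> reflection a b \in Phi;
  root_cryst : forall a b : E,
    a \in Phi -> b \in Phi -> cartan a b \is a Num.int }.

(* The elements are injective (weyl_root), so u^-1 is the genuine inverse. *)
Inductive weyl (Phi : {fset E}) : set 'End(E) :=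
  | weyl_refl a : a \in Phi -> weyl Phi (reflection a)
  | weyl_id : weyl Phi \1%VF
  | weyl_comp u v : weyl Phi u -> weyl Phi v -> weyl Phi (u \o v)%VF
  | weyl_inv u : weyl Phi u -> weyl Phi (u^-1)%VF.

Section WeylFinite.
Variable Phi : {fset E}.
Hypothesis rootPhi : root_system Phi.

Lemma reflectionK a : a \in Phi -> involutive (reflection a).
Proof.
move=> aPhi x; rewrite !lfunE /= /reflect_fun /cartan.
have a0 : a != 0.
  by apply: contraNneq (root_neq0 rootPhi) => <-.
have q0 : form a a != 0 by rewrite gt_eqF ?neq0_dnorm_gt0.
have -> : 2 * form a (x - (2 * form a x / form a a) *: a) / form a a
    = - (2 * form a x / form a a).
  by rewrite linearBr linearZr /=; field.
by rewrite scaleNr opprK subrK.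
Qed.

Lemma weyl_root w : weyl Phi w ->
  lker w == 0%VS /\ {in Phi, forall a, w a \in Phi}.
Proof.
elim=> {w} [a aPhi||u v _ [ku uP] _ [kv vP]|u _ [ku uP]].
- split; first exact/lker0P/inv_inj/reflectionK.
  by move=> b bPhi; apply: (root_stable rootPhi).
- by split=> [|a aPhi]; rewrite ?id_lfunE //; apply/lker0P => x y; rewrite !id_lfunE.
- split; last by move=> a aPhi; rewrite comp_lfunE; apply/uP/vP.
  by apply/lker0P => x y; rewrite !comp_lfunE => /(lker0P ku)/(lker0P kv).
- split; first exact/lker0P/(can_inj (lker0_lfunVK ku)).
  move=> a aPhi.
  have /fsubset_cardP eqP : #|` [fset u b | b in Phi]%fset| = #|` Phi|.
    by rewrite card_imfset //=; apply/lker0P.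
  have sP : ([fset u b | b in Phi] `<=` Phi)%fset.
    by apply/fsubsetP => _ /imfsetP[b /= bPhi ->]; apply: uP.
  move: (eqP sP a); rewrite aPhi => /imfsetP[b /= bPhi ->].
  by rewrite lker0_lfunK.
Qed.

Lemma weyl_finite : finite_set (weyl Phi).
Proof.
pose f (w : 'End(E)) := [ffun x : Phi => insubd x (w (val x))].
apply: card_le_finite (finite_finset (X := range f)).
have finj : {in weyl Phi &, injective f}.
  move=> u v; rewrite !inE => Wu Wv /ffunP fuv.
  apply/eqP; rewrite -subr_eq0; apply/eqP/lfunP => x; rewrite zero_lfunE.
  apply/eqP; rewrite -memv_ker; have : x \in <<Phi>>%VS.
    by rewrite (root_span rootPhi) memvf.
  apply/subvP: x; apply/span_subvP => a aPhi; rewrite memv_ker.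
  have := congr1 val (fuv [` aPhi]%fset); rewrite !ffunE !insubdK //.
  - by move=> /= eq_uv; rewrite add_lfunE opp_lfunE eq_uv subrr.
  - exact: (weyl_root Wv).2.
  - exact: (weyl_root Wu).2.
rewrite -(card_le_eql (inj_card_eq finj)); apply: subset_card_le.
by move=> _ [w _ <-]; exists w.
Qed.

End WeylFinite.

End RootSystem.

Section Positive.
Context {R : realType} {E : vectType R}.
Variables (Phi : {fset E}) (r : nat) (Delta : r.-tuple E).

Record simple_roots : Prop := SimpleRoots {
  simple_root : {subset Delta <= Phi};
  simple_basis : basis_of fullv Delta;
  simple_coef : forall a : E, a \in Phi ->
    exists c : 'I_r -> int,
      a = \sum_(i < r) Delta`_i *~ c i /\
      ((forall i, 0 <= c i) \/ (forall i, c i <= 0)) }.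

Definition nonneg_comb (x : E) : Prop :=
  exists c : 'I_r -> R,
    (forall i, 0 <= c i) /\ x = \sum_(i < r) c i *: Delta`_i.

Definition pos_roots : {fset E} :=
  [fset a in Phi | `[< nonneg_comb a >]]%fset.

Definition neg_roots : {fset E} := [fset - a | a in pos_roots]%fset.

Definition root_le (a b : E) : Prop := nonneg_comb (b - a).

Definition order_ideal (A : {fset E}) : Prop :=
  (A `<=` pos_roots)%fset /\
  (forall a b : E, a \in pos_roots -> b \in A -> root_le a b -> a \in A).

Definition inversions (w : 'End(E)) : {fset E} :=
  [fset a in pos_roots | w a \in neg_roots]%fset.

Definition weyl_within (form : {dot E for idfun}) (A : {fset E}) :
    set 'End(E) :=
  [set w | weyl form Phi w /\ (inversions w `<=` A)%fset].

(* Subsets of the Weyl group are finite (weyl_finite), hence the use of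
   finite sets of endomorphisms. *)
Definition generalized_semiorder (form : {dot E for idfun})
    (C : {fset 'End(E)}) : Prop :=
  exists A : {fset E}, order_ideal A /\ [set` C] = weyl_within form A.

Definition inv_fraction (C : {fset 'End(E)}) (a : E) : R :=
  #|` [fset w in C | a \in inversions w]%fset|%:R / #|` C|%:R.

(* The values are nonnegative when C is nonempty, so the default value 0 of
   the iterated maximum only matters when there are no roots at all. *)
Definition balance_constant (C : {fset 'End(E)}) : R :=
  \big[Num.max/0]_(a <- pos_roots)
    Num.min (inv_fraction C a) (1 - inv_fraction C a).

End Positive.

(* Main.v *)
(* Let C = W^A. If g is an inversion of w in C then w s_g is again in C and g
   is not an inversion of it; hence every root is inverted by at most half of
   C. Pick a simple root a as in [exists_almost_stable_simple], with its
   exceptional root b. If a is not an inversion of w in C, then either w s_a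
   lies in C and has the inversion a, or b is an inversion of w. So
   1 <= 2 delta(a) + delta(b), and delta(a) or delta(b) is at least 1/3 while
   being at most 1/2. *)
Require Import Defs.
From mathcomp Require Import all_boot all_order all_algebra finmap.
From mathcomp Require Import boolp classical_sets functions cardinality reals.
From mathcomp Require Import ring lra.

Set Implicit Arguments.
Unset Strict Implicit.
Unset Printing Implicit Defensive.

Import Order.TTheory GRing.Theory Num.Theory.

Local Open Scope ring_scope.

(** * Reflections as isometries *)

Section Reflections.
Context {R : realType} {E : vectType R}.
Variable form : {dot E for idfun}.

Local Notation refl := (reflection form).

Lemma formC x y : form x y = form y x.
Proof. by rewrite hermC /= expr0 mul1r. Qed.

Lemma cartan_reflection g x : g != 0 ->
  cartan form g (refl g x) = - cartan form g x.
Proof.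
move=> g0; have q0 : form g g != 0 by rewrite gt_eqF ?neq0_dnorm_gt0.
by rewrite reflectionE /cartan linearBr linearZr /=; field.
Qed.

Lemma reflection_cartan g x : refl g x = x - cartan form g x *: g.
Proof. exact: reflectionE. Qed.

Lemma cartan_self g : g != 0 -> cartan form g g = 2.
Proof.
move=> g0; have q0 : form g g != 0 by rewrite gt_eqF ?neq0_dnorm_gt0.
by rewrite /cartan; field.
Qed.

Lemma reflection_self g : g != 0 -> refl g g = - g.
Proof.
move=> g0; rewrite reflection_cartan cartan_self // scaler_nat mulr2n.
by rewrite opprD addNKr.
Qed.

Lemma reflectionN g : refl (- g) = refl g.
Proof.
apply/lfunP => x; rewrite !reflectionE linearNl linearNl linearNr opprK.
by rewrite mulrN mulNr scaleNr scalerN opprK.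
Qed.

Lemma form_reflection g x y : g != 0 ->
  form (refl g x) (refl g y) = form x y.
Proof.
move=> g0; have q0 : form g g != 0 by rewrite gt_eqF ?neq0_dnorm_gt0.
rewrite !reflectionE linearBl !linearBr !linearZl /= !linearZr /=.
by rewrite (formC x g); field.
Qed.

(** The conjugation rule [u s_g u^-1 = s_(u g)], multiplied through by [u] so that no inverse has to
    be handled. *)
Lemma reflection_conj (u : 'End(E)) g :
  (forall x y, form (u x) (u y) = form x y) ->
  (refl (u g) \o u)%VF = (u \o refl g)%VF.
Proof.
move=> uI; apply/lfunP => x.
by rewrite !comp_lfunE !reflectionE !uI linearB /= (linearZZ u).
Qed.

End Reflections.

(** * Positive roots and coordinates in the basis of simple roots *)

Section PositiveRoots.
Context {R : realType} {E : vectType R}.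
Variables (form : {dot E for idfun}) (Phi : {fset E}).
Variables (r : nat) (Delta : r.-tuple E).
Hypotheses (rootPhi : root_system form Phi) (simpleD : simple_roots Phi Delta).

Local Notation refl := (reflection form).
Local Notation pos := (pos_roots Phi Delta).
Local Notation inv := (inversions Phi Delta).

Lemma simple_free : free Delta.
Proof. exact: (basis_free (simple_basis simpleD)). Qed.

Lemma simple_sum x : x = \sum_(i < r) coord Delta i x *: Delta`_i.
Proof. exact: coord_basis (simple_basis simpleD) (memvf x). Qed.

Lemma nonneg_combP x :
  nonneg_comb Delta x <-> forall i, 0 <= coord Delta i x.
Proof.
split=> [[c [c0 ->]] i|x0]; first by rewrite coord_sum_free ?simple_free.
by exists (fun i => coord Delta i x); split=> //; apply: simple_sum.
Qed.

Lemma nonneg_combD x y :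
  nonneg_comb Delta x -> nonneg_comb Delta y -> nonneg_comb Delta (x + y).
Proof.
rewrite !nonneg_combP => x0 y0 i.
by rewrite linearD /= addr_ge0.
Qed.

Lemma nonneg_combZ c x :
  0 <= c -> nonneg_comb Delta x -> nonneg_comb Delta (c *: x).
Proof.
rewrite !nonneg_combP => c0 x0 i.
by rewrite linearZ /= mulr_ge0.
Qed.

Lemma nonneg_comb_anti x :
  nonneg_comb Delta x -> nonneg_comb Delta (- x) -> x = 0.
Proof.
rewrite !nonneg_combP => x0 x1; rewrite (simple_sum x) big1 // => i _.
have := x1 i; rewrite linearN /= oppr_ge0 => /(conj (x0 i))/andP/le_anti <-.
by rewrite scale0r.
Qed.

Lemma nonneg_comb_simple i : nonneg_comb Delta Delta`_(i : 'I_r).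
Proof.
by rewrite nonneg_combP => j; rewrite coord_free ?simple_free // ler0n.
Qed.

Lemma root_neq0E a : a \in Phi -> a != 0.
Proof. by apply: contraTneq => ->; exact: (root_neq0 rootPhi). Qed.

Lemma rootN a : a \in Phi -> - a \in Phi.
Proof.
move=> aP; rewrite -(reflection_self form (root_neq0E aP)).
exact: (root_stable rootPhi aP aP).
Qed.

Lemma posP a : reflect (a \in Phi /\ nonneg_comb Delta a) (a \in pos).
Proof.
by rewrite !inE; apply: (iffP andP) => -[? ?]; split=> //; apply/asboolP.
Qed.

Lemma pos_root a : a \in pos -> a \in Phi.
Proof. by case/posP. Qed.

Lemma pos_nonneg a : a \in pos -> nonneg_comb Delta a.
Proof. by case/posP. Qed.

Lemma neg_rootsE a : (a \in neg_roots Phi Delta) = (- a \in pos).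
Proof.
apply/imfsetP/idP => [[b bP ->]|aP]; first by rewrite opprK.
by exists (- a); rewrite ?opprK.
Qed.

Lemma root_posVneg a : a \in Phi -> (a \in pos) || (- a \in pos).
Proof.
move=> aP; have [c [a_sum cs]] := simple_coef simpleD aP.
case: cs => cs; apply/orP; [left|right]; apply/posP; split; rewrite ?rootN //.
- exists (fun i => (c i)%:~R); split=> [i|]; first by rewrite ler0z.
  by rewrite a_sum; apply: eq_bigr => i _; rewrite scaler_int.
- exists (fun i => (- c i)%:~R); split=> [i|]; first by rewrite ler0z oppr_ge0.
  rewrite a_sum -sumrN; apply: eq_bigr => i _.
  by rewrite scaler_int mulrNz.
Qed.

Lemma posN a : a \in Phi -> (- a \in pos) = (a \notin pos).
Proof.
move=> aP; case: (boolP (a \in pos)) => ap; last first.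
  by have := root_posVneg aP; rewrite (negPf ap).
apply/negP => nap; have := root_neq0E aP; apply/negP; rewrite negbK.
by apply/eqP/nonneg_comb_anti; apply: pos_nonneg.
Qed.

Lemma inversionsP (w : 'End(E)) a :
  reflect (a \in pos /\ - w a \in pos) (a \in inv w).
Proof. by rewrite -neg_rootsE !inE /=; exact: andP. Qed.

Lemma simple_pos (i : 'I_r) : Delta`_i \in pos.
Proof.
apply/posP; split; last exact: nonneg_comb_simple.
by apply: (simple_root simpleD); rewrite mem_nth ?size_tuple.
Qed.

(* A positive root other than [Delta`_i] is not proportional to it, so one of
   its other coordinates is positive, and the reflection preserves it. *)
Lemma reflection_simple_pos (i : 'I_r) g :
  g \in pos -> g != Delta`_i -> refl Delta`_i g \in pos.
Proof.
move=> gp; apply: contraNT => sg; set a := Delta`_i.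
have gP := pos_root gp; have aP := pos_root (simple_pos i).
have sP : refl a g \in Phi by exact: (root_stable rootPhi aP gP).
have gi : g = coord Delta i g *: a.
  rewrite {1}(simple_sum g) (bigD1 i) //= big1 ?addr0 // => j ji.
  have := posN sP; rewrite sg => /pos_nonneg/nonneg_combP/(_ j).
  rewrite linearN reflection_cartan linearB linearZ /= coord_free ?simple_free //.
  rewrite eq_sym (negPf ji) mulr0 subr0 oppr_ge0 => gj.
  have /nonneg_combP/(_ j) gj' := pos_nonneg gp.
  by rewrite (le_anti (introT andP (conj gj gj'))) scale0r.
have := gP; rewrite gi => /(root_reduced rootPhi aP)[ci|ci].
  by rewrite ci scale1r.
have /nonneg_combP/(_ i) := pos_nonneg gp.
by rewrite ci ler0N1.
Qed.

(** Otherwise expanding one argument of [form x x] in simple roots gives a sum of nonpositive terms,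
    against positive definiteness. *)
Lemma exists_form_simple_gt0 x :
  nonneg_comb Delta x -> x != 0 -> exists i : 'I_r, 0 < form Delta`_i x.
Proof.
move=> /nonneg_combP x0 xn0; apply/not_existsP => le0.
have : 0 < form x x by rewrite neq0_dnorm_gt0.
apply/negP; rewrite -leNgt {1}(simple_sum x) formC linear_sumr /=.
apply: sumr_le0 => i _; rewrite linearZr /= mulr_ge0_le0 // leNgt formC.
exact/negP/le0.
Qed.

(** * Words in simple reflections and the exchange property *)

Lemma reflection_comp_self a : a \in Phi -> (refl a \o refl a)%VF = \1%VF.
Proof.
by move=> aP; apply/lfunP => x; rewrite comp_lfunE id_lfunE (reflectionK rootPhi).
Qed.

Fixpoint word_prod (s : seq 'I_r) : 'End(E) :=
  if s is i :: t then (refl Delta`_i \o word_prod t)%VF else \1%VF.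

Lemma word_prod_cat s t :
  word_prod (s ++ t) = (word_prod s \o word_prod t)%VF.
Proof. by elim: s => [|i s /= ->]; rewrite ?comp_lfun1l ?comp_lfunA. Qed.

Lemma simple_rootE (i : 'I_r) : Delta`_i \in Phi.
Proof. exact: pos_root (simple_pos i). Qed.

Lemma form_word_prod s x y :
  form (word_prod s x) (word_prod s y) = form x y.
Proof.
elim: s => [|i s IHs] /=; rewrite ?id_lfunE ?comp_lfunE //.
by rewrite form_reflection ?IHs // root_neq0E ?simple_rootE.
Qed.

Lemma word_prod_root s a : a \in Phi -> word_prod s a \in Phi.
Proof.
move=> aP; elim: s => [|i s IHs] /=; rewrite ?id_lfunE ?comp_lfunE //.
exact: (root_stable rootPhi (simple_rootE i) IHs).
Qed.

Lemma word_prod_rev s : (word_prod (rev s) \o word_prod s)%VF = \1%VF.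
Proof.
elim: s => [|i s IHs]; first by rewrite /= comp_lfun1l.
rewrite rev_cons -cats1 word_prod_cat /= comp_lfun1r comp_lfunA.
rewrite -[in X in (X \o _)%VF]comp_lfunA reflection_comp_self ?simple_rootE //.
by rewrite comp_lfun1r.
Qed.

Lemma word_prod_exchange s (i : 'I_r) : - word_prod s Delta`_i \in pos ->
  exists2 t, (size t < size s)%N & (word_prod s \o refl Delta`_i)%VF = word_prod t.
Proof.
elim: s => [|j s IHs] /=.
  by rewrite id_lfunE posN ?simple_rootE // simple_pos.
rewrite comp_lfunE; set b := word_prod s _ => sb.
have bP : b \in Phi by rewrite word_prod_root ?simple_rootE.
have [bp|bn] := boolP (b \in pos); last first.
  have [|t ts st] := IHs; first by rewrite posN.
  by exists (j :: t); rewrite //= -st comp_lfunA.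
have bj : b = Delta`_j.
  apply/eqP; apply: contraTT sb => bj.
  rewrite posN ?negbK ?reflection_simple_pos //.
  exact: (root_stable rootPhi (simple_rootE j) bP).
exists s => //; rewrite -comp_lfunA -(reflection_conj _ (form_word_prod s)).
rewrite -/b bj comp_lfunA reflection_comp_self ?simple_rootE //.
by rewrite comp_lfun1l.
Qed.

Lemma word_prod_eq1 s :
  (forall i : 'I_r, word_prod s Delta`_i \in pos) -> word_prod s = \1%VF.
Proof.
have [n] := ubnP (size s); elim: n s => // n IHn s; rewrite ltnS => sn sp.
case/lastP: s => [//|t i] in sn sp *.
have s_prod : word_prod (rcons t i) = (word_prod t \o refl Delta`_i)%VF.
  by rewrite -cats1 word_prod_cat /= comp_lfun1r.
have [|u ut tu] := @word_prod_exchange t i.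
  have := sp i; rewrite s_prod comp_lfunE reflection_self ?linearN //.
  by rewrite root_neq0E ?simple_rootE.
rewrite s_prod tu; apply: IHn => [|j]; last by rewrite -tu -s_prod.
by apply: leq_trans ut (leq_trans _ sn); rewrite size_rcons.
Qed.

(** Induction on the height [h]: a simple [a] with [form a b > 0] gives a lower positive root
    [s_a b], and [s_b = s_a s_(s_a b) s_a]. *)
Lemma pos_reflection_word b : b \in pos -> exists s, refl b = word_prod s.
Proof.
pose h x := \sum_(i < r) coord Delta i x.
(* Heights are real numbers here, so the induction counts the positive roots of smaller height. *)
have [n] := ubnP #|` [fset c in pos | h c < h b]%fset|.
elim: n b => // n IHn b; rewrite ltnS => hb bp.
have bP := pos_root bp.
have [i ib] := exists_form_simple_gt0 (pos_nonneg bp) (root_neq0E bP).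
have aP := simple_rootE i; set a := Delta`_i in ib aP *.
have [->|ba] := eqVneq b a.
  by exists [:: i]; rewrite /= comp_lfun1r.
have c0 : 0 < cartan form a b.
  by rewrite divr_gt0 ?mulr_gt0 // neq0_dnorm_gt0 ?root_neq0E.
have sb : refl a b \in pos by apply: reflection_simple_pos.
have hs : h (refl a b) < h b.
  (* Only the coordinate [i] changes; it drops by [cartan form a b]. *)
  rewrite /h reflection_cartan -subr_gt0 -sumrB (bigD1 i) //= big1 => [|j ji].
    rewrite addr0 linearB linearZ /= coord_free ?simple_free // eqxx mulr1.
    by rewrite opprB addrC subrK.
  rewrite linearB linearZ /= coord_free ?simple_free // eq_sym (negPf ji).
  by rewrite mulr0 subr0 subrr.
have [|t st] := IHn (refl a b) _ sb.
  apply: leq_trans hb; apply: fproper_ltn_card; rewrite fproperE; apply/andP; split.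
    apply/fsubsetP => c; rewrite !inE => /andP[-> /lt_trans]; exact.
  apply/fsubsetPn; exists (refl a b); move: sb; rewrite !inE /= => ->.
    by rewrite hs.
  by rewrite ltxx.
exists (i :: t ++ [:: i]); rewrite /= word_prod_cat /= comp_lfun1r -st.
rewrite comp_lfunA -/a -(reflection_conj (refl a b)).
  rewrite (reflectionK rootPhi) // -comp_lfunA reflection_comp_self //.
  by rewrite comp_lfun1r.
by move=> x y; rewrite form_reflection // root_neq0E.
Qed.

Lemma weyl_word w : weyl form Phi w -> exists s, w = word_prod s.
Proof.
elim=> {w} [a aP||u v _ [s ->] _ [t ->]|u Wu [s us]].
- case/orP: (root_posVneg aP) => [|/pos_reflection_word].
    exact: pos_reflection_word.
  by rewrite reflectionN.
- by exists [::].
- by exists (s ++ t); rewrite word_prod_cat.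
- exists (rev s); have [ku _] := weyl_root rootPhi Wu.
  rewrite -[LHS]comp_lfun1l -(word_prod_rev s) -us -comp_lfunA.
  by rewrite lker0_compfV // comp_lfun1r.
Qed.

(** This serves to show that [A] is nonempty: an empty [A] would leave only the identity in [C]. *)
Lemma weyl_inversions0 w : weyl form Phi w -> inv w = fset0 -> w = \1%VF.
Proof.
move=> Ww w0; have [s ws] := weyl_word Ww; rewrite ws; apply: word_prod_eq1 => i.
rewrite -ws; have wi := (weyl_root rootPhi Ww).2 _ (simple_rootE i).
apply: contraFT (in_fset0 Delta`_i) => wn; rewrite -w0; apply/inversionsP.
by rewrite posN // simple_pos.
Qed.

Lemma nonneg_comb_sum (B : {fset E}) :
  (B `<=` pos)%fset -> nonneg_comb Delta (\sum_(b <- B) b).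
Proof.
move=> /fsubsetP Bpos; rewrite big_seq; apply: big_ind.
- by apply/nonneg_combP => i; rewrite linear0.
- exact: nonneg_combD.
- by move=> b /Bpos/pos_nonneg.
Qed.

(** * Order ideals and the sets [W^A] *)

Section OrderIdeal.
Variable A : {fset E}.
Hypothesis idealA : order_ideal Phi Delta A.

Local Notation WA := (weyl_within Phi Delta form A).

Lemma ideal_pos a : a \in A -> a \in pos.
Proof. by have [/fsubsetP + _] := idealA; apply. Qed.

Lemma inversions_reflection (w : 'End(E)) g :
  g \in inv w -> g \notin inv (w \o refl g)%VF.
Proof.
case/inversionsP=> gp wg; have gP := pos_root gp.
have wgP : w g \in Phi by rewrite -(opprK (w g)) rootN // (pos_root wg).
apply/negP => /inversionsP[_].
rewrite comp_lfunE reflection_self ?root_neq0E // linearN opprK.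
by apply/negP; rewrite -posN.
Qed.

(** Let [b] be an inversion of [w s_g] and [k] its Cartan number with [g]. If [k >= 0], then
    [- w b = - w (s_g b) + k (- w g)] is positive, so [w] inverts [b]. If [k < 0], then
    [s_g b = b - k g] is a positive root above [b] that [w] inverts; it lies in [A], hence so does
    [b]. *)
Lemma weyl_within_reflection w g :
  WA w -> g \in inv w -> WA (w \o refl g)%VF.
Proof.
move=> [Ww wA] /inversionsP[gp wg]; have gP := pos_root gp.
split; first exact: weyl_comp Ww (weyl_refl _ gP).
apply/fsubsetP => b /inversionsP[bp]; rewrite comp_lfunE => wsb.
have bP := pos_root bp; have sP := root_stable rootPhi gP bP.
have wbP := (weyl_root rootPhi Ww).2 _ bP.
have sE := reflection_cartan form g b; set k := cartan form g b in sE.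
have bE : b = refl g b + k *: g by rewrite sE subrK.
have [k0|k0] := leP 0 k.
  apply: (fsubsetP wA); apply/inversionsP; split=> //.
  apply/posP; split; first exact: rootN.
  rewrite bE linearD linearZ opprD -scalerN.
  by apply: nonneg_combD (nonneg_combZ k0 _); apply: pos_nonneg.
have kg : nonneg_comb Delta (- k *: g).
  by apply: nonneg_combZ (pos_nonneg gp); rewrite oppr_ge0 ltW.
have sp : refl g b \in pos.
  apply/posP; split=> //; rewrite sE -scaleNr.
  exact: nonneg_combD (pos_nonneg bp) kg.
apply: (idealA.2 _ (refl g b)) => //.
  by apply: (fsubsetP wA); apply/inversionsP.
by rewrite /root_le sE addrAC subrr add0r -scaleNr.
Qed.

(* Write S for the sum of A. As S is a nonnegative combination of simple roots
   with (S, S) > 0, some simple root a has <S, a^v> > 0. In the sum of the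
   integers <b, a^v> over A, the roots b with both b and s_a b in A \ {a}
   cancel, a itself contributes 2, and each b with s_a b outside A contributes
   at most -1; so a lies in A and there is at most one root of the last kind. *)
Lemma exists_almost_stable_simple : A != fset0 ->
  exists2 a : E, a \in A /\ (exists i : 'I_r, a = Delta`_i) &
    exists2 b0, b0 \in pos &
      forall b, b \in A -> b != a -> refl a b \notin A -> b = b0.
Proof.
case/fset0Pn=> b1 b1A; pose S := \sum_(b <- A) b.
have Snn : nonneg_comb Delta S by apply: nonneg_comb_sum idealA.1.
(* If [S = 0], then [- b1] is the sum of the other roots of [A], so both [b1] and [- b1] are
   nonnegative combinations. *)
have Sn0 : S != 0.
  apply/eqP => S0; have b1p := ideal_pos b1A.
  have := root_neq0E (pos_root b1p); apply/negP; rewrite negbK.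
  apply/eqP/nonneg_comb_anti; first exact: pos_nonneg.
  have := S0; rewrite /S (big_fsetD1 b1) //= => /eqP.
  rewrite addrC addr_eq0 => /eqP <-; apply: nonneg_comb_sum.
  exact: fsubset_trans (fsubD1set _ _) idealA.1.
have [i Si] := exists_form_simple_gt0 Snn Sn0.
have ap := simple_pos i; have aP := simple_rootE i; set a := Delta`_i in Si ap aP.
have a0 : a != 0 := root_neq0E aP.
have sK : involutive (refl a) := reflectionK rootPhi aP.
pose f := cartan form a; pose A' := (A `\ a)%fset.
have fs b : f (refl a b) = - f b by rewrite /f cartan_reflection.
have fS : \sum_(b <- A) f b = f S.
  by rewrite /f /cartan /S linear_sumr mulr_sumr mulr_suml.
have fS0 : 0 < \sum_(b <- A) f b.
  by rewrite fS divr_gt0 ?mulr_gt0 // neq0_dnorm_gt0.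
have fA : \sum_(b <- A) f b = (if a \in A then 2 else 0) + \sum_(b <- A') f b.
  case: ifPn => aA; last by rewrite add0r /A' mem_fsetD1.
  by rewrite (big_fsetD1 a) //= /f cartan_self.
pose B := [fset b in A' | refl a b \in A']%fset.
pose D := [fset b in A' | refl a b \notin A']%fset.
have fBD : \sum_(b <- A') f b = \sum_(b <- B) f b + \sum_(b <- D) f b.
  exact: big_fsetID.
have fB : \sum_(b <- B) f b = 0.
  have permB : perm_eq [seq refl a b | b <- B] B.
    apply: uniq_perm; rewrite ?(map_inj_uniq (inv_inj sK)) ?fset_uniq // => b.
    apply/mapP/idP => [[c + ->]|bB].
      by rewrite !inE sK => /andP[-> ->].
    by exists (refl a b) => //; move: bB; rewrite ?sK // !inE sK => /andP[-> ->].
  have : \sum_(b <- B) f b = - \sum_(b <- B) f b.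
    rewrite -{1}(perm_big _ permB) big_map -sumrN.
    by apply: eq_bigr => b _; apply: fs.
  by move=> ?; lra.
(* Since [s_a b = a] would mean [b = - a], the test [s_a b \notin A'] that defines [D] agrees with
   [s_a b \notin A]. *)
have sA' b : b \in A' -> refl a b \in pos /\ refl a b != a.
  rewrite in_fsetD1 => /andP[ba bA]; have bp := ideal_pos bA; split.
    exact: reflection_simple_pos.
  apply: contraTneq bp => sba.
  by rewrite -[b]sK sba reflection_self // posN // ap.
have Df b : b \in D -> f b <= -1.
  rewrite in_fset /= inE => /andP[bA' sbA'].
  have [sbp sba] := sA' _ bA'; move: bA' sbA'; rewrite !in_fsetD1 sba /= => /andP[ba bA].
  have bP := pos_root (ideal_pos bA).
  (* If [f b >= 0], then [s_a b] lies below [b] and the ideal contains it. By integrality, negative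
     means at most -1. *)
  move=> sbA; have : f b < 0.
    rewrite ltNge; apply: contra sbA => fb0.
    apply: (idealA.2 _ b) => //.
    rewrite /root_le reflection_cartan opprB addrC subrK.
    exact: nonneg_combZ (pos_nonneg ap).
  rewrite /f; have /intrP[m ->] := root_cryst rootPhi aP bP.
  by rewrite ltrz0 -[-1]/((-1)%:~R) ler_int -ltzD1 addNr.
have fD : \sum_(b <- D) f b <= - #|` D|%:R.
  rewrite big_seq; apply: (@le_trans _ _ (\sum_(b <- D | b \in D) -1)).
    exact: ler_sum.
  by rewrite -big_seq big_const_seq count_predT iter_addr_0 mulNrn.
have [aA D2] : a \in A /\ (#|` D| < 2)%N.
  rewrite fA fBD fB add0r in fS0; have := ler0n R #|` D|.
  case: ifP fS0 => _ ? ?; last by lra.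
  by split=> //; rewrite -(ltr_nat R); lra.
exists a; first by split=> //; exists i.
have DP b : b \in A -> b != a -> refl a b \notin A -> b \in D.
  by move=> bA ba sbA; rewrite !inE ba bA negb_and sbA orbT.
(* Without an exceptional root any positive root can serve as [b0]; [a] is taken. *)
have [D0|Dn0] := eqVneq D fset0.
  by exists a => // b bA ba /(DP _ bA ba); rewrite D0 in_fset0.
have /cardfs1P[b0 Db0] : #|` D| == 1%N.
  by rewrite eqn_leq -ltnS D2 cardfs_gt0.
exists b0 => [|b bA ba /(DP _ bA ba)]; last by rewrite Db0 => /fset1P.
apply: ideal_pos; have : b0 \in D by rewrite Db0 fset11.
by rewrite !inE => /andP[/andP[]].
Qed.

(** * Counting the elements of [C] that invert a given root *)

Variable C : {fset 'End(E)}.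
Hypothesis CE : [set` C]%classic = WA.

Local Notation inverting g := [fset w in C | g \in inv w]%fset.

Lemma in_inverting g (w : 'End(E)) :
  (w \in inverting g) = (w \in C) && (g \in inv w).
Proof. by rewrite !inE. Qed.

Lemma semiorderP w : w \in C <-> WA w.
Proof. by have /predeqP/(_ w) := CE. Qed.

Definition flip g : {fset 'End(E)} :=
  [fset (w \o refl g)%VF | w in inverting g]%fset.

Lemma comp_reflectionK g : g \in Phi ->
  involutive (fun w : 'End(E) => (w \o refl g)%VF).
Proof.
by move=> gP w; rewrite -comp_lfunA reflection_comp_self // comp_lfun1r.
Qed.

Lemma card_flip g : g \in Phi -> #|` flip g| = #|` inverting g|.
Proof. by move=> gP; rewrite card_imfset //; apply/inv_inj/comp_reflectionK. Qed.

Lemma flip_sub g : (flip g `<=` C `\` inverting g)%fset.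
Proof.
apply/fsubsetP => _ /imfsetP[w /= + ->]; rewrite in_inverting => /andP[wC gw].
rewrite in_fsetD in_inverting negb_and (inversions_reflection gw) orbT /=.
by apply/semiorderP/weyl_within_reflection; first exact/semiorderP.
Qed.

(** [flip g] and [inverting g] are disjoint subsets of [C] of equal size. *)
Lemma card_inverting_le_half g : g \in Phi -> (#|` inverting g|.*2 <= #|` C|)%N.
Proof.
move=> gP; rewrite -(cardfsID (inverting g) C) -addnn leq_add //.
  rewrite fsubset_leq_card //; apply/fsubsetP => w.
  by rewrite in_fsetI in_inverting => /andP[-> ->].
by rewrite -card_flip // fsubset_leq_card // flip_sub.
Qed.

(** A fraction of at most one half is itself the minimum in the balance constant. *)
Lemma inv_fraction_le_balance g : g \in pos ->
  inv_fraction Phi Delta C g <= balance_constant Phi Delta C.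
Proof.
move=> gp; have half := card_inverting_le_half (pos_root gp).
apply: bigmax_sup_seq gp _ _ => //.
rewrite le_min lexx /= /inv_fraction.
have [C0|C0] := posnP #|` C|; first by rewrite C0 invr0 mulr0; lra.
suff : #|` inverting g|%:R / #|` C|%:R * 2 <= (1 : R) by lra.
by rewrite mulrAC ler_pdivrMr ?ltr0n // mul1r -natrM muln2 ler_nat.
Qed.

(* If a is not an inversion of w in C and w s_a is not in C, an inversion of
   w s_a outside A is the mirror image of the exceptional root b0. *)
Lemma card_semiorder_le : (1 < #|` C|)%N ->
  exists2 a, a \in pos & exists2 b, b \in pos &
    (#|` C| <= #|` inverting a|.*2 + #|` inverting b|)%N.
Proof.
move=> C1; have [|a [aA [i ai]] [b0 b0p exc]] := exists_almost_stable_simple.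
  apply: contraTneq C1 => A0; rewrite -leqNgt -(cardfs1 (\1%VF : 'End(E))).
  apply/fsubset_leq_card/fsubsetP => w /semiorderP[Ww].
  by rewrite A0 fsubset0 => /eqP/(weyl_inversions0 Ww) ->; apply: fset11.
have ap := ideal_pos aA; have aP := pos_root ap.
have sK : involutive (refl a) := reflectionK rootPhi aP.
exists a => //; exists b0 => //.
suff sub : (C `<=` inverting a `|` flip a `|` inverting b0)%fset.
  apply: leq_trans (fsubset_leq_card sub) _; rewrite -addnn -{2}card_flip //.
  rewrite cardfsU (leq_trans (leq_subr _ _)) // leq_add2r.
  by rewrite cardfsU leq_subr.
apply/fsubsetP => w wC; have [Ww wA] := (semiorderP w).1 wC.
rewrite !in_fsetU; have [aw|aw] := boolP (a \in inv w).
  by rewrite in_inverting wC aw.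
have w'K := comp_reflectionK aP w; set w' := (w \o refl a)%VF in w'K.
have [w'C|w'C] := boolP (w' \in C).
  apply/orP; left; apply/orP; right; apply/imfsetP; exists w' => //=.
  rewrite in_inverting w'C /=; apply/inversionsP; split=> //.
  rewrite comp_lfunE reflection_self ?root_neq0E // linearN opprK.
  move: aw; apply: contraNT => waN; apply/inversionsP; split=> //.
  by rewrite posN //; apply: (weyl_root rootPhi Ww).2.
apply/orP; right; rewrite in_inverting wC /=.
have Ww' : weyl form Phi w' := weyl_comp Ww (weyl_refl _ aP).
have /fsubsetPn[g /inversionsP[gp w'g] gA] : ~~ (inv w' `<=` A)%fset.
  by apply: contra w'C => w'A; apply/semiorderP.
have ga : g != a by apply: contraNneq gA => ->.
have bp : refl a g \in pos by rewrite ai reflection_simple_pos // -ai.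
(* [w (s_a g) = w' g] is negative, so [s_a g] lies in [A] while its mirror image [g] does not; [exc]
   then identifies it with [b0]. *)
have bw : refl a g \in inv w by apply/inversionsP; rewrite -comp_lfunE.
rewrite -(exc (refl a g)) // ?sK //; first exact: (fsubsetP wA).
apply: contraTneq gp => sga.
by rewrite -[g]sK sga reflection_self ?root_neq0E // posN // ap.
Qed.

End OrderIdeal.
End PositiveRoots.

Theorem theorem4p4 (R : realType) (E : vectType R) (form : {dot E for idfun})
    (Phi : {fset E}) (r : nat) (Delta : r.-tuple E) (C : {fset 'End(E)}) :
  root_system form Phi ->
  simple_roots Phi Delta ->
  generalized_semiorder Phi Delta form C ->
  (1 < #|` C|)%N ->
  1 / 3 <= balance_constant Phi Delta C.
Proof.
move=> rootPhi simpleD [A [idealA CE]] C1.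
have [a ap [b bp]] := card_semiorder_le rootPhi simpleD idealA CE C1.
have := inv_fraction_le_balance rootPhi simpleD idealA CE ap.
have := inv_fraction_le_balance rootPhi simpleD idealA CE bp.
rewrite /inv_fraction -(ler_nat R) natrD -addnn natrD.
set c := #|` C|%:R; set x := #|` _|%:R; set y := #|` _|%:R => xb yb cxy.
have c0 : 0 < c by rewrite ltr0n (ltn_trans _ C1).
rewrite ler_pdivrMr // in xb; rewrite ler_pdivrMr // in yb.
(* Both counts are at most [c] times the balance constant, so [c] is at most three times that
   product. *)
rewrite -(ler_pM2r c0); lra.
Qed.
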